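(* Let $\mathbf{A}$ be an additive category, let $\mathcal{O}$ be a class of objects of $\mathbf{A}$ containing $0$ and closed under isomorphism, and let $w$ be a weight on $\mathcal{O}$. Then $|d_w|_{\mathcal{O}}\le w$, i.e. $d_w(A,0)\le w(A)$ for all $A\in\mathcal{O}$.
   Context: A weight on $\mathcal{O}$ is an assignment of $w(A)\in[0,\infty]$ to each $A\in\mathcal{O}$ such that $w(0)=0$ and $w(A)=w(B)$ whenever $A\cong B$. Path metric $d_w$: let $\mathcal{M}$ be the class of morphisms $f$ in $\mathbf{A}$ whose kernel and cokernel both exist and are in $\mathcal{O}$, and put $w(f)=w(\ker f)+w(\operatorname{coker}f)$ for $f\in\mathcal{M}$. A zigzag from $A$ to $B$ is a finite sequence of morphisms joining $A=A_0,A_1,\dots,A_n=B$ ($n\ge0$), the $i$-th one being a morphism between $A_{i-1}$ and $A_i$ in either direction. The cost of a zigzag all of whose morphisms are in $\mathcal{M}$ is the sum of the weights of its morphisms (and $0$ if $n=0$). $d_w(A,B)\in[0,\infty]$ is the infimum of the costs of all zigzags from $A$ to $B$ whose morphisms all lie in $\mathcal{M}$ ($\infty$ if there are none). For a metric $d$ on $\mathbf{A}$, $|d|_{\mathcal{O}}$ is the weight on $\mathcal{O}$ given by $A\mapsto d(A,0)$. *)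

(* Defs.v *)
From HB Require Import structures.
From mathcomp Require Import all_boot all_order all_algebra.
From mathcomp Require Import all_classical all_reals ereal.

Set Implicit Arguments.
Unset Strict Implicit.
Unset Printing Implicit Defensive.

Import Order.TTheory GRing.Theory Num.Theory.
Local Open Scope classical_set_scope.
Local Open Scope ring_scope.
Local Open Scope ereal_scope.

(* Hom-sets are zmodTypes; over the classical axioms of boolp every abelian
   group carries the eqType/choiceType structure this requires. *)
Record preadditive_cat := PreadditiveCat {
  cat_obj :> Type;
  homset : cat_obj -> cat_obj -> zmodType;
  idm : forall A, homset A A;
  compm : forall A B C, homset B C -> homset A B -> homset A C;
  compm_idl : forall A B (f : homset A B), compm (idm B) f = f;
  compm_idr : forall A B (f : homset A B), compm f (idm A) = f;
  compmA : forall A B C D (h : homset C D) (g : homset B C) (f : homset A B),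
    compm h (compm g f) = compm (compm h g) f;
  compmDl : forall A B C (g g' : homset B C) (f : homset A B),
    compm (g + g')%R f = (compm g f + compm g' f)%R;
  compmDr : forall A B C (g : homset B C) (f f' : homset A B),
    compm g (f + f')%R = (compm g f + compm g f')%R
}.

Notation "g \co f" := (compm g f) (at level 40, left associativity).

Definition is_zero_object (C : preadditive_cat) (Z : C) : Prop :=
  forall A : C, (exists! f : homset Z A, True) /\ (exists! f : homset A Z, True).

Definition is_biproduct (C : preadditive_cat) (A B P : C) (i1 : homset A P)
    (i2 : homset B P) (p1 : homset P A) (p2 : homset P B) : Prop :=
  [/\ p1 \co i1 = idm A, p2 \co i2 = idm B, p1 \co i2 = 0%R, p2 \co i1 = 0%R
    & (i1 \co p1 + i2 \co p2)%R = idm P].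

Record additive_cat := AdditiveCat {
  additive_pre :> preadditive_cat;
  zero_obj : additive_pre;
  zero_objP : is_zero_object zero_obj;
  biproductP : forall A B : additive_pre,
    exists (P : additive_pre) (i1 : homset A P) (i2 : homset B P)
           (p1 : homset P A) (p2 : homset P B), is_biproduct i1 i2 p1 p2
}.

Section Morphisms.
Variable C : additive_cat.

Definition isomorphic (A B : C) : Prop :=
  exists (f : homset A B) (g : homset B A), g \co f = idm A /\ f \co g = idm B.

Definition is_kernel (A B K : C) (f : homset A B) (k : homset K A) : Prop :=
  f \co k = 0%R /\
  forall (T : C) (t : homset T A), f \co t = 0%R -> exists! u : homset T K, k \co u = t.

Definition is_cokernel (A B Q : C) (f : homset A B) (q : homset B Q) : Prop :=
  q \co f = 0%R /\
  forall (T : C) (t : homset B T), t \co f = 0%R -> exists! u : homset Q T, u \co q = t.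

Definition has_kernel (A B : C) (f : homset A B) : Prop :=
  exists (K : C) (k : homset K A), is_kernel f k.

Definition has_cokernel (A B : C) (f : homset A B) : Prop :=
  exists (Q : C) (q : homset B Q), is_cokernel f q.

(* A chosen (co)kernel object, unique up to isomorphism; the zero object is a
   junk value, used only when no (co)kernel exists. *)
Definition ker_obj (A B : C) (f : homset A B) : C :=
  if pselect (has_kernel f) is left h then projT1 (cid h) else zero_obj C.

Definition coker_obj (A B : C) (f : homset A B) : C :=
  if pselect (has_cokernel f) is left h then projT1 (cid h) else zero_obj C.

End Morphisms.

Section PathMetric.
Variables (R : realType) (C : additive_cat).

Definition iso_closed (O : set C) : Prop :=
  forall A B : C, isomorphic A B -> O A -> O B.

(* Only the values of w on O are constrained or ever used. *)
Definition is_weight (O : set C) (w : C -> \bar R) : Prop :=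
  [/\ forall A, O A -> 0 <= w A,
      w (zero_obj C) = 0
    & forall A B, O A -> O B -> isomorphic A B -> w A = w B].

Definition admissible (O : set C) (A B : C) (f : homset A B) : Prop :=
  [/\ has_kernel f, has_cokernel f, O (ker_obj f) & O (coker_obj f)].

Definition mor_weight (w : C -> \bar R) (A B : C) (f : homset A B) : \bar R :=
  w (ker_obj f) + w (coker_obj f).

Inductive zigzag : C -> C -> Type :=
| zz_nil A : zigzag A A
| zz_fwd A A1 B (f : homset A A1) (z : zigzag A1 B) : zigzag A B
| zz_bwd A A1 B (f : homset A1 A) (z : zigzag A1 B) : zigzag A B.

Fixpoint zz_admissible (O : set C) (A B : C) (z : zigzag A B) : Prop :=
  match z with
  | zz_nil _ => True
  | zz_fwd _ _ _ f z' => admissible O f /\ zz_admissible O z'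
  | zz_bwd _ _ _ f z' => admissible O f /\ zz_admissible O z'
  end.

Fixpoint zz_cost (w : C -> \bar R) (A B : C) (z : zigzag A B) : \bar R :=
  match z with
  | zz_nil _ => 0
  | zz_fwd _ _ _ f z' => mor_weight w f + zz_cost w z'
  | zz_bwd _ _ _ f z' => mor_weight w f + zz_cost w z'
  end.

(* ereal_inf set0 = +oo covers the case of no zigzag in the class. *)
Definition path_metric (O : set C) (w : C -> \bar R) (A B : C) : \bar R :=
  ereal_inf [set zz_cost w z | z in [set z : zigzag A B | zz_admissible O z]].

Definition metric_weight (d : C -> C -> \bar R) (A : C) : \bar R :=
  d A (zero_obj C).

End PathMetric.

(* Main.v *)
Require Import Defs.
From HB Require Import structures.
From mathcomp Require Import all_boot all_order all_algebra.
From mathcomp Require Import all_classical all_reals ereal.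

(** The zero morphism [A -> 0] has kernel [A] and cokernel [0], so it is a
    one-step zigzag from [A] to [0] of cost [w A + w 0 = w A]. *)

Set Implicit Arguments.
Unset Strict Implicit.
Unset Printing Implicit Defensive.

Local Open Scope ereal_scope.

(** Composites with [0] vanish, so [idm A] is a kernel of [0 : A -> 0] and the identity of the zero
    object is a cokernel. Weights, however, are read off the chosen [ker_obj] and [coker_obj], which
    agree with these only up to isomorphism. [ker_obj_iso] and [coker_obj_iso] give the
    isomorphisms, along which membership in [O] and values of [w] are transported. *)

Lemma comp0m (C : preadditive_cat) (X Y Z : C) (f : homset X Y) :
  (0%R : homset Y Z) \co f = 0%R.
Proof.
by apply: (@GRing.addrI _ (0%R \co f)); rewrite -compmDl !GRing.addr0.
Qed.

Lemma compm0 (C : preadditive_cat) (X Y Z : C) (g : homset Y Z) :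
  g \co (0%R : homset X Y) = 0%R.
Proof.
by apply: (@GRing.addrI _ (g \co 0%R)); rewrite -compmDr !GRing.addr0.
Qed.

Lemma is_kernel_zero (C : additive_cat) (X Y : C) :
  is_kernel (0%R : homset X Y) (idm X).
Proof.
split; first exact: comp0m.
move=> T t _; exists t; split; first exact: compm_idl.
by move=> u <-; rewrite compm_idl.
Qed.

Lemma is_cokernel_zero (C : additive_cat) (X Y : C) :
  is_cokernel (0%R : homset X Y) (idm Y).
Proof.
split; first exact: compm0.
move=> T t _; exists t; split; first exact: compm_idr.
by move=> u <-; rewrite compm_idr.
Qed.

(** Each kernel map factors through the other; both [v \co u] and the identity are the unique
    endomorphism [e] with [k \co e = k], and likewise for [k']. *)
Lemma kernel_unique (C : additive_cat) (X Y K K' : C) (f : homset X Y)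
    (k : homset K X) (k' : homset K' X) :
  is_kernel f k -> is_kernel f k' -> isomorphic K K'.
Proof.
move=> [fk univ] [fk' univ'].
have [u [ku _]] := univ' _ _ fk; have [v [kv _]] := univ _ _ fk'.
exists u, v; split.
- have [e [_ eU]] := univ _ _ fk.
  rewrite -(eU (v \co u)); last by rewrite compmA kv.
  by apply: eU; rewrite compm_idr.
- have [e [_ eU]] := univ' _ _ fk'.
  rewrite -(eU (u \co v)); last by rewrite compmA ku.
  by apply: eU; rewrite compm_idr.
Qed.

Lemma cokernel_unique (C : additive_cat) (X Y Q Q' : C) (f : homset X Y)
    (q : homset Y Q) (q' : homset Y Q') :
  is_cokernel f q -> is_cokernel f q' -> isomorphic Q Q'.
Proof.
move=> [qf univ] [qf' univ'].
have [u [uq _]] := univ _ _ qf'; have [v [vq _]] := univ' _ _ qf.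
exists u, v; split.
- have [e [_ eU]] := univ _ _ qf.
  rewrite -(eU (v \co u)); last by rewrite -compmA uq.
  by apply: eU; rewrite compm_idl.
- have [e [_ eU]] := univ' _ _ qf'.
  rewrite -(eU (u \co v)); last by rewrite -compmA vq.
  by apply: eU; rewrite compm_idl.
Qed.

Lemma ker_obj_iso (C : additive_cat) (X Y K : C) (f : homset X Y)
    (k : homset K X) : is_kernel f k -> isomorphic K (ker_obj f).
Proof.
(* The default branch cannot occur, as [k] witnesses [has_kernel f]. *)
move=> fk; rewrite /ker_obj; case: pselect => [h|[]]; last by exists K, k.
by case: cid => K' /= [k' /(kernel_unique fk)].
Qed.

Lemma coker_obj_iso (C : additive_cat) (X Y Q : C) (f : homset X Y)
    (q : homset Y Q) : is_cokernel f q -> isomorphic Q (coker_obj f).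
Proof.
move=> fq; rewrite /coker_obj; case: pselect => [h|[]]; last by exists Q, q.
by case: cid => Q' /= [q' /(cokernel_unique fq)].
Qed.

Theorem lemma3p20 (R : realType) (C : additive_cat) (O : set C)
  (w : C -> \bar R)
  (hO0 : O (zero_obj C))
  (hOiso : iso_closed O)
  (hw : is_weight O w) :
  forall A : C, O A -> metric_weight (path_metric O w) A <= w A.
Proof.
move=> A OA; case: hw => _ w0 wiso.
pose f : homset A (zero_obj C) := 0%R.
have kerA := is_kernel_zero A (zero_obj C).
have coker0 := is_cokernel_zero A (zero_obj C).
have isoK : isomorphic A (ker_obj f) := ker_obj_iso kerA.
have isoQ : isomorphic (zero_obj C) (coker_obj f) := coker_obj_iso coker0.
(* Closure of [O] under isomorphism makes [f] admissible. *)
have OK := hOiso _ _ isoK OA.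
have OQ := hOiso _ _ isoQ hO0.
apply: ereal_inf_lbound; exists (zz_fwd f (zz_nil (zero_obj C))).
  by split=> //; split=> //; [exists A, (idm A) | exists (zero_obj C), (idm _)].
(* By invariance of [w] the cost is [w A + 0 + 0], the last term coming from the empty tail. *)
rewrite /= /mor_weight -(wiso _ _ OA OK isoK) -(wiso _ _ hO0 OQ isoQ) w0.
by rewrite !adde0.
Qed.
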